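(* Let $G$ be a locally compact abelian group and let $\varphi\in B(G)$ be real-valued and odd (i.e. $\varphi(-x)=-\varphi(x)$ for all $x\in G$). If $\|\varphi\|_{B(G)}\le 1$, then there exists a characteristic function $f$ on $G$ such that $\operatorname{Im} f(x)=\varphi(x)$ for all $x\in G$.
   Context: $\widehat{G}$ denotes the dual group of $G$ (continuous homomorphisms $\gamma:G\to\{z\in\mathbb{C}:|z|=1\}$), written additively, with $(x,\gamma)=\gamma(x)$. $M(\widehat{G})$ is the Banach algebra of bounded regular complex Borel measures on $\widehat{G}$ with the total variation norm. For $\omega\in M(\widehat{G})$, its Fourier–Stieltjes transform is $\widehat{\omega}(x)=\int_{\widehat{G}}\overline{(x,\gamma)}\,d\omega(\gamma)$, $x\in G$. $B(G)=\{\widehat{\omega}:\omega\in M(\widehat{G})\}$ is the Fourier–Stieltjes algebra, normed by $\|\widehat{\omega}\|_{B(G)}=\|\omega\|_{M(\widehat{G})}$. A characteristic function on $G$ is a function of the form $\widehat{\mu}$ with $\mu$ a nonnegative measure in $M(\widehat{G})$ with $\|\mu\|=1$ (equivalently, by Bochner's theorem, a continuous positive definite function $f$ on $G$ with $f(0)=1$). *)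

(* Defs.v *)
From HB Require Import structures.
From mathcomp Require Import all_boot all_order all_algebra.
From mathcomp Require Import all_classical all_reals all_analysis.
From mathcomp Require Import complex.
Import Order.TTheory GRing.Theory Num.Theory.
Import numFieldTopology.Exports numFieldNormedType.Exports.

Set Implicit Arguments.
Unset Strict Implicit.
Unset Printing Implicit Defensive.

Local Open Scope ring_scope.
Local Open Scope classical_set_scope.
Local Open Scope complex_scope.

Definition borel (T : ptopologicalType) := g_sigma_algebraType (@open T).

(* The complex plane C = R[i] carries its usual (norm) topology, R[i]^o.     *)
Section dual_group.
Variables (R : realType) (G : topologicalZmodType).

Definition is_character (g : G -> R[i]) : Prop :=
  [/\ continuous (g : G -> (R[i])^o),
      (forall x y, g (x + y) = g x * g y) &
      (forall x, `|g x| = 1)].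

Definition characters : set {compact-open, G -> (R[i])^o} :=
  [set g | is_character g].

(* the dual group \hat G, with the subspace topology of the compact-open one *)
Definition dual_group : Type := set_type characters.

HB.instance Definition _ := Topological.on dual_group.

Lemma trivial_character_in :
  (fun _ : G => (1 : R[i])) \in characters.
Proof.
rewrite inE; split.
- by move=> x; exact: cvg_cst.
- by move=> x y; rewrite mulr1.
- by move=> x; rewrite normr1.
Qed.

HB.instance Definition _ :=
  isPointed.Build dual_group
    (exist (fun g => g \in characters) _ trivial_character_in).

Definition pairing (x : G) (gamma : dual_group) : R[i] :=
  (set_val gamma : G -> R[i]) x.

End dual_group.

Section complex_measures.
Context d (T : measurableType d) (R : realType).

Record cmeasure := CMeasure {
  cm_re : {charge set T -> \bar R} ;
  cm_im : {charge set T -> \bar R} }.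

Definition cm_val (w : cmeasure) (A : set T) : R[i] :=
  (fine (cm_re w A)) +i* (fine (cm_im w A)).

Definition measurable_partition (A : set T) (F : nat -> set T) : Prop :=
  [/\ (forall n, measurable (F n)), trivIset setT F & \bigcup_n F n = A].

Definition cm_variation (w : cmeasure) (A : set T) : \bar R :=
  ereal_sup [set s | exists F, measurable_partition A F /\
     s = (\sum_(0 <= n <oo) (complex.Re `|cm_val w (F n)|)%:E)%E].

Definition cm_norm (w : cmeasure) : \bar R := cm_variation w setT.

Definition charge_integral (nu : {charge set T -> \bar R}) (f : T -> R) : R :=
  let: exist P HP := cid (Hahn_decomposition nu) in
  let: exist N HPN := cid HP in
  fine (\int[jordan_pos HPN]_x (f x)%:E)%E
    - fine (\int[jordan_neg HPN]_x (f x)%:E)%E.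

Definition cm_integral (w : cmeasure) (f : T -> R[i]) : R[i] :=
  (charge_integral (cm_re w) (fun x => complex.Re (f x))
     - charge_integral (cm_im w) (fun x => complex.Im (f x))) +i*
  (charge_integral (cm_re w) (fun x => complex.Im (f x))
     + charge_integral (cm_im w) (fun x => complex.Re (f x))).

Definition measure_integral (mu : {measure set T -> \bar R}) (f : T -> R[i])
  : R[i] :=
  (fine (\int[mu]_x (complex.Re (f x))%:E)%E) +i*
  (fine (\int[mu]_x (complex.Im (f x))%:E)%E).

End complex_measures.

Definition regular_setfun (T : ptopologicalType) (R : realType)
    (m : set (borel T) -> \bar R) : Prop :=
  forall A : set (borel T), measurable A ->
    m A = ereal_sup [set m K | K in [set K : set T | compact K /\ K `<=` A]] /\
    m A = ereal_inf [set m U | U in [set U : set T | open U /\ A `<=` U]].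

Definition cm_regular (T : ptopologicalType) (R : realType)
    (w : cmeasure (borel T) R) : Prop :=
  regular_setfun (cm_variation w).

Definition fourier_stieltjes (R : realType) (G : topologicalZmodType)
    (w : cmeasure (borel (dual_group R G)) R) (x : G) : R[i] :=
  cm_integral w (fun gamma => conjc (pairing x gamma)).

Definition fourier_stieltjes_meas (R : realType) (G : topologicalZmodType)
    (mu : {measure set borel (dual_group R G) -> \bar R}) (x : G) : R[i] :=
  measure_integral mu (fun gamma => conjc (pairing x gamma)).

Definition in_B_unit_ball (R : realType) (G : topologicalZmodType)
    (phi : G -> R[i]) : Prop :=
  exists w : cmeasure (borel (dual_group R G)) R,
    [/\ cm_regular w, (cm_norm w <= 1)%E & forall x, fourier_stieltjes w x = phi x].

Definition characteristic_function (R : realType) (G : topologicalZmodType)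
    (f : G -> R[i]) : Prop :=
  exists mu : {measure set borel (dual_group R G) -> \bar R},
    [/\ mu setT = 1%E, regular_setfun mu &
        forall x, f x = fourier_stieltjes_meas mu x].

(* Main.v *)
(** Write the representing measure of [phi] as [w = a + i b] with [a], [b] real.
    Since [phi] is real and odd, only the sine part of [b] survives in the real
    part of the transform: [phi x = \int Im (gamma x) db]. With the Jordan
    decomposition [b = b+ - b-] and the inversion [s] of the dual group,
    [mu = b- + s_* b+ + (1 - |b|) delta_1] is a probability measure, because
    [|b| <= ||w|| <= 1]; inversion changes the sign of the sine, which vanishes
    at the trivial character, so the imaginary part of the transform of [mu] is
    [\int Im (gamma x) db]. *)

Require Import Defs.
From HB Require Import structures.
From mathcomp Require Import all_boot all_order all_algebra.
From mathcomp Require Import all_classical all_reals all_analysis.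
From mathcomp Require Import complex lra measurable_realfun.
Import Order.TTheory GRing.Theory Num.Theory.
Import numFieldTopology.Exports numFieldNormedType.Exports.
Local Open Scope ring_scope.
Local Open Scope complex_scope.

(** * Bounds on the complex modulus *)

Lemma abs_im_le_norm {R : realType} (z : R[i]) :
  `|complex.Im z| <= complex.Re `|z|.
Proof.
rewrite normc_def/= -sqrtr_sqr ler_sqrt; first by rewrite lerDr sqr_ge0.
by rewrite addr_ge0 ?sqr_ge0.
Qed.

Lemma re_norm_ge0 {R : realType} (z : R[i]) : 0 <= complex.Re `|z|.
Proof. by rewrite normc_def/= sqrtr_ge0. Qed.

(** * Tight finite Borel measures and regularity *)

Section inner_tightness.
Context {R : realType} {T : ptopologicalType}.
Local Open Scope classical_set_scope.
Local Open Scope ereal_scope.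
Implicit Type m : {measure set borel T -> \bar R}.

(** Inner regularity in epsilon form: unlike an equality of suprema, it passes directly to smaller
    measures, sums and images. *)
Definition tight (m : set (borel T) -> \bar R) : Prop :=
  forall A : set (borel T), measurable A -> forall e : R, (0 < e)%R ->
  exists K : set T, [/\ compact K, K `<=` A & m (A `\` K) <= e%:E].

Lemma measurable_open (U : set T) : open U -> measurable (U : set (borel T)).
Proof. exact: sub_sigma_algebra. Qed.

Lemma measurable_closed (F : set T) :
  closed F -> measurable (F : set (borel T)).
Proof.
move=> Fc; rewrite -(setCK F); apply: measurableC.
by apply: measurable_open; exact: closed_openC.
Qed.

Hypothesis T_hausdorff : hausdorff_space T.

Lemma measurable_compact (K : set T) :
  compact K -> measurable (K : set (borel T)).
Proof. by move=> Kc; apply: measurable_closed; exact: compact_closed. Qed.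

(* Outer regularity of A is inner tightness of its complement. *)
Lemma tight_regular m : m setT < +oo -> tight m -> regular_setfun m.
Proof.
move=> mfin mt A mA.
have fin (B : set (borel T)) : measurable B -> m B < +oo.
  by move=> mB; apply: le_lt_trans mfin; apply: le_measure; rewrite ?inE.
have split_measure (B C : set (borel T)) : measurable B -> measurable C ->
    C `<=` B -> m B = m C + m (B `\` C).
  move=> mB mC CB; rewrite -measureU//; [|exact: measurableD|].
    by congr (m _); rewrite setDUK.
  by rewrite setDE setICA setICr setI0.
split; apply/eqP; rewrite eq_le; apply/andP; split.
- apply/lee_addgt0Pr => e e0; have [K [Kc KA mAK]] := mt A mA e e0.
  rewrite (split_measure A K)//; last exact: measurable_compact.
  by apply: leeD => //; apply: ereal_sup_ubound; exists K.
- apply: ge_ereal_sup => _ [K [Kc KA] <-].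
  by apply: le_measure; rewrite ?inE//; exact: measurable_compact.
- apply: le_ereal_inf_tmp => _ [U [Uo AU] <-].
  by apply: le_measure; rewrite ?inE//; exact: measurable_open.
- apply/lee_addgt0Pr => e e0; have [K [Kc KA mAK]] := mt _ (measurableC mA) e e0.
  have Ko : open (~` K) by by apply: closed_openC; exact: compact_closed.
  apply: (@le_trans _ _ (m (~` K))).
    apply: ereal_inf_lbound; exists (~` K) => //; split => //.
    by rewrite -(setCK A); exact: subsetC.
  rewrite (split_measure (~` K) A)//.
  + by apply: leeD => //; rewrite setDE setIC -setDE.
  + exact: measurable_open.
  + by rewrite -(setCK A); exact: subsetC.
Qed.

Lemma tight_le m (m' : set (borel T) -> \bar R) :
  (forall A, measurable A -> m A <= m' A) -> tight m' -> tight m.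
Proof.
move=> mm' m't A mA e e0; have [K [Kc KA mK]] := m't A mA e e0.
exists K; split => //; apply: le_trans mK; apply: mm'.
by apply: measurableD => //; exact: measurable_compact.
Qed.

Lemma tight_add m1 m2 : tight m1 -> tight m2 -> tight (measure_add m1 m2).
Proof.
move=> t1 t2 A mA e e0; have e20 : (0 < e / 2)%R by rewrite divr_gt0.
have [K [Kc KA mK]] := t1 A mA _ e20.
have [L [Lc LA mL]] := t2 A mA _ e20.
have [mK' mL'] := (measurable_compact _ Kc, measurable_compact _ Lc).
exists (K `|` L); split; [exact: compactU|by rewrite subUset|].
rewrite measure_addE (splitr e) EFinD; apply: leeD.
- apply: le_trans mK; apply: le_measure; rewrite ?inE.
  + by apply: measurableD => //; exact: measurableU.
  + exact: measurableD.
  + by apply: setDS; exact: subsetUl.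
- apply: le_trans mL; apply: le_measure; rewrite ?inE.
  + by apply: measurableD => //; exact: measurableU.
  + exact: measurableD.
  + by apply: setDS; exact: subsetUr.
Qed.

Lemma tight_scaled_dirac (k : {nonneg R}) (a : T) :
  tight (mscale k (@dirac _ (borel T) a R)).
Proof.
move=> A mA e e0; have [aA|aA] := pselect (A a).
  exists [set a]; split; [exact: compact_set1|by move=> _ ->|].
  rewrite /mscale/= diracE memNset ?mule0 ?lee_fin ?ltW//.
  by move=> [_]; apply.
exists set0; split; [exact: compact0|exact: sub0set|].
by rewrite /mscale/= diracE setD0 memNset ?mule0 ?lee_fin ?ltW.
Qed.

Lemma continuous_measurable_borel (f : T -> T) :
  continuous f -> measurable_fun setT (f : borel T -> borel T).
Proof.
move=> /continuousP fc.
apply: (@measurability _ _ (borel T) (borel T) setT f (@open T)) => //.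
by move=> _ [U Uo <-]; rewrite setTI; apply: measurable_open; exact: fc.
Qed.

(** A compact chosen for the preimage of [A] is carried into [A] by [f]; injectivity of [f] makes
    the preimage of the remainder exactly the old remainder. *)
Lemma tight_pushforward m (f : T -> T) : continuous f -> involutive f ->
  tight m -> tight (pushforward m (f : borel T -> borel T)).
Proof.
move=> fc fK mt A mA e e0.
have mfA : measurable (f @^-1` A : set (borel T)).
  by rewrite -(setTI (f @^-1` A)); exact: (continuous_measurable_borel _ fc).
have [K [Kc KA mK]] := mt _ mfA e e0.
exists (f @` K); split.
- by apply: continuous_compact => //; exact: continuous_subspaceT.
- by move=> _ [x Kx <-]; exact: KA.
- rewrite /pushforward (_ : f @^-1` (A `\` f @` K) = f @^-1` A `\` K)//.
  apply/seteqP; split => x [/= Ax nx]; split => //.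
  + by move=> Kx; apply: nx; exists x.
  + by move=> [y Ky /(can_inj fK) yx]; apply: nx; rewrite -yx.
Qed.

Lemma continuous_measurable_real (f : T -> R) :
  continuous f -> measurable_fun setT (f : borel T -> R).
Proof.
move=> /continuousP fc.
apply: (measurability _ (RGenOpens.measurableE R)) => _ [_ [a [b ->] <-]].
by rewrite setTI; apply: measurable_open; apply: fc; exact: interval_open.
Qed.

End inner_tightness.

(** * Total variation against the Jordan parts of the imaginary charge *)

Section variation.
Context {d} {T : measurableType d} {R : realType}.
Local Open Scope classical_set_scope.
Local Open Scope ereal_scope.
Variable w : cmeasure T R.

Lemma cm_variation_ge0 (A : set T) : measurable A -> 0 <= cm_variation w A.
Proof.
(* A supremum over no partition would be [-oo], so one is exhibited: [A] followed by empty sets. *)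
move=> mA; apply: (@le_trans _ _ (\sum_(0 <= n <oo)
    (complex.Re `|cm_val w (if n is 0%N then A else set0)|)%:E)).
  by apply: nneseries_ge0 => n _ _; rewrite lee_fin re_norm_ge0.
apply: ereal_sup_ubound; exists (fun n => if n is 0%N then A else set0).
split=> //; split.
- by case.
- by move=> [|i] [|j] _ _ [x []].
- by apply/seteqP; split => [x [[|n] _ //]|x Ax]; exists 0%N.
Qed.

Section hahn.
Variables (P N : set T) (PN : hahn_decomposition (cm_im w) P N).

(* A Hahn splitting of B, followed by a partition of C, partitions B `|` C. *)
Lemma jordan_add_variation_le (B C : set T) : measurable B -> measurable C ->
  B `&` C = set0 ->
  measure_add (jordan_pos PN) (jordan_neg PN) B + cm_variation w C
    <= cm_variation w (B `|` C).
Proof.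
move=> mB mC BC.
have [[mP _] [mN _] PNT PN0] := PN.
have mBP : measurable (B `&` P) by exact: measurableI.
have mBN : measurable (B `&` N) by exact: measurableI.
have posE : jordan_pos PN B = cm_im w (B `&` P).
  by rewrite jordan_posE cjordan_posE /crestr0 mem_set.
have negE : jordan_neg PN B = - cm_im w (B `&` N).
  by rewrite jordan_negE cjordan_negE /crestr0 mem_set.
have addE : measure_add (jordan_pos PN) (jordan_neg PN) B =
    cm_im w (B `&` P) - cm_im w (B `&` N).
  by rewrite measure_addE -negE -posE.
(* Finiteness lets the Jordan mass of [B] change sides, so that the supremum over partitions of [C]
   can be opened and then moved back. *)
have fin : measure_add (jordan_pos PN) (jordan_neg PN) B \is a fin_num.
  by rewrite addE fin_numB !fin_num_measure.
rewrite -leeBrDl//; apply: ge_ereal_sup => _ [F [[mF tF FC] ->]].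
rewrite leeBrDl//.
(* The two Hahn pieces of [B] come first, and the partition of [C] is shifted by two. *)
pose F' n := match n with 0%N => B `&` P | 1%N => B `&` N | n.+2 => F n end.
have F'ge0 n : 0 <= (complex.Re `|cm_val w (F' n)|)%:E.
  by rewrite lee_fin re_norm_ge0.
apply: (@le_trans _ _ (\sum_(0 <= n <oo) (complex.Re `|cm_val w (F' n)|)%:E)).
  (* On each Hahn piece the Jordan mass is plus or minus the imaginary part of [w], hence at most
     its modulus; the tail is the sum over [F]. *)
  rewrite [leRHS](nneseries_split 0 2); last by move=> k _; exact: F'ge0.
  rewrite add0n big_nat_recr// big_nat1 -(nneseries_addn 2)//.
  apply: leeD; last by under [leRHS]eq_eseriesr do rewrite addn2.
  rewrite addE; apply: leeD.
  - rewrite -[leLHS]fineK ?fin_num_measure// lee_fin.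
    by apply: le_trans (abs_im_le_norm _); exact: ler_norm.
  - rewrite -[leLHS]fineK ?fin_numN ?fin_num_measure// lee_fin fineN.
    by apply: le_trans (abs_im_le_norm _); rewrite -normrN; exact: ler_norm.
have FsubC n : F n `<=` C by rewrite -FC; exact: bigcup_sup.
apply: ereal_sup_ubound; exists F'; split => //; split.
- by case=> [|[|n]] /=.
- have disjBC i x : B x -> F i x -> False.
    by move=> Bx /FsubC Cx; have : (B `&` C) x by []; rewrite BC.
  have disjPN x : P x -> N x -> False.
    by move=> Px Nx; have : (P `&` N) x by []; rewrite PN0.
  move=> [|[|i]] [|[|j]] _ _ // [x [/= Fx Gx]].
  + by case: Fx Gx => _ /disjPN nN [_ /nN].
  + by case: Fx => /disjBC /(_ Gx).
  + by case: Fx Gx => _ Nx [_ /disjPN /(_ Nx)].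
  + by case: Fx => /disjBC /(_ Gx).
  + by case: Gx => /disjBC /(_ Fx).
  + by case: Gx => /disjBC /(_ Fx).
  + by congr (_.+2); apply: (tF i j) => //; exists x.
- apply/seteqP; split => [x [[|[|n]] _ /=]|x].
  + by case; left.
  + by case; left.
  + by move/FsubC; right.
  + case=> [Bx|]; last by rewrite -FC => -[n _ Fx]; exists n.+2.
    have : (P `|` N) x by rewrite PNT.
    by case=> ?; [exists 0%N|exists 1%N].
Qed.

Lemma jordan_le_variation (B : set T) : measurable B ->
  measure_add (jordan_pos PN) (jordan_neg PN) B <= cm_variation w B.
Proof.
move=> mB; rewrite -[X in _ <= cm_variation w X]setU0.
apply: le_trans (jordan_add_variation_le _ _ mB measurable0 (setI0 _)).
by rewrite leeDl// cm_variation_ge0.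
Qed.

(** Apply the superadditive bound with [B] the complement of [A] and drop the nonnegative Jordan
    mass. *)
Lemma cm_variation_le_norm (A : set T) : measurable A ->
  cm_variation w A <= cm_norm w.
Proof.
move=> mA; rewrite /cm_norm -(setvU A).
apply: le_trans (jordan_add_variation_le _ _ (measurableC mA) mA (setICl A)).
by rewrite leeDr.
Qed.

End hahn.
End variation.

(** * Tightness inherited from a regular complex measure *)

Section jordan_tight.
Context {R : realType} {T : ptopologicalType}.
Local Open Scope classical_set_scope.
Local Open Scope ereal_scope.
Hypothesis T_hausdorff : hausdorff_space T.

(** The superadditive bound on [A \ K] and [K] controls the Jordan mass of [A \ K] by the variation
    of [A] minus that of [K]; inner regularity supplies a [K] making this gap less than [e]. *)
Lemma jordan_tight (w : cmeasure (borel T) R) (P N : set (borel T))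
    (PN : hahn_decomposition (cm_im w) P N) :
  cm_regular w -> cm_norm w < +oo ->
  tight (measure_add (jordan_pos PN) (jordan_neg PN)).
Proof.
move=> wreg wfin A mA e e0.
have fin (B : set (borel T)) : measurable B -> cm_variation w B \is a fin_num.
  move=> mB; rewrite ge0_fin_numE ?cm_variation_ge0//.
  exact: le_lt_trans (cm_variation_le_norm _ _ _ PN _ mB) wfin.
have [VA _] := wreg A mA.
have := fin _ mA; rewrite VA => /(ub_ereal_sup_adherent e0)[_ [K [Kc KA] <-]].
rewrite -VA => VK; have mK := measurable_compact T_hausdorff _ Kc.
exists K; split => //.
have := jordan_add_variation_le _ _ _ PN (A `\` K) K (measurableD mA mK) mK.
rewrite setDKI setDKU// => /(_ erefl); rewrite -leeBrDr ?fin//.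
move=> /le_trans; apply; rewrite leeBlDr ?fin// addeC -leeBlDr//.
exact: ltW.
Qed.

End jordan_tight.

(** * Continuity of imaginary part and conjugation *)

Section complex_continuity.
Context {R : realType}.
Local Open Scope classical_set_scope.

Lemma continuous_Im : continuous (@complex.Im R : (R[i])^o -> R).
Proof.
move=> z U /= /(@nbhs_ballP R R) [e /= e0 eU].
(* Radii of balls in [R[i]] are themselves complex, so the real radius is embedded. *)
have eC0 : 0 < e%:C :> R[i] by rewrite ltcR.
apply/(@nbhs_ballP R[i] (R[i])^o); exists e%:C => //= y.
rewrite -ball_normE /= => zy; apply: eU; rewrite -ball_normE /= -raddfB.
apply: le_lt_trans (abs_im_le_norm _) _.
by move: zy; rewrite ltcE => /andP[].
Qed.

Lemma continuous_conjc : continuous (@conjc R : (R[i])^o -> (R[i])^o).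
Proof.
move=> z U /= /(@nbhs_ballP R[i] (R[i])^o) [e /= e0 eU].
apply/(@nbhs_ballP R[i] (R[i])^o); exists e => //= y.
by rewrite -ball_normE /= => zy; apply: eU;
  rewrite -ball_normE /= -rmorphB normcJ.
Qed.

End complex_continuity.

(** * Topology and inversion of the dual group *)

Section dual_group_theory.
Context {R : realType} {G : topologicalZmodType}.
Local Open Scope classical_set_scope.
Local Notation D := (dual_group R G).
Implicit Types (x y : G) (g : D).

Lemma pairing_is_character g : is_character (fun x => pairing x g).
Proof. by case: g => g /= gP; exact: (set_mem gP). Qed.

(** Singletons are compact, so evaluation at a point is continuous for the compact-open topology. *)
Lemma continuous_pairing x : continuous (pairing x : D -> (R[i])^o).
Proof.
move=> g; pose ev (h : {compact-open, G -> (R[i])^o}) : (R[i])^o := h x.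
apply: (@continuous_comp D _ _ (set_val : D -> {compact-open, G -> (R[i])^o}) ev).
  exact: initial_continuous.
move=> U /=; rewrite nbhsE => -[V [Vo Vx] VU].
exists [set h : {compact-open, G -> (R[i])^o} | h @` [set x] `<=` V]; split.
- by apply: compact_open_open => //; exact: compact_set1.
- by move=> _ [_ -> <-].
- by move=> h hV; apply: VU; apply: hV; exists x.
Qed.

(** Evaluations are continuous into a Hausdorff space and together separate characters. *)
Lemma dual_group_hausdorff : hausdorff_space D.
Proof.
move=> g h gh; apply/val_inj/funext => x.
apply: (@norm_hausdorff _ (R[i])^o) => A B Ag Bh.
have [k [Ak Bk]] := gh _ _ (continuous_pairing x g A Ag)
  (continuous_pairing x h B Bh).
by exists (pairing x k).
Qed.

Lemma conj_character_in g : (fun x => conjc (pairing x g)) \in @characters R G.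
Proof.
have [gc gD g1] := pairing_is_character g; rewrite inE; split.
- by move=> x; apply: continuous_comp; [exact: gc|exact: continuous_conjc].
- by move=> x y; rewrite gD rmorphM.
- by move=> x; rewrite normcJ g1.
Qed.

(** Inversion in the dual group, since characters have modulus one. *)
Definition conj_character g : D :=
  exist (fun h => h \in @characters R G) _ (conj_character_in g).

Lemma pairing_conj x g : pairing x (conj_character g) = conjc (pairing x g).
Proof. by []. Qed.

Lemma conj_characterK : involutive conj_character.
Proof.
by move=> g; apply/val_inj/funext => x /=; rewrite pairing_conj conjcK.
Qed.

(** The conjugate of [h] maps [K] into [V] as soon as [h] maps [K] into the open set of conjugates
    of points of [V]. *)
Lemma continuous_conj_character : continuous conj_character.
Proof.
apply: continuous_comp_initial => g.
apply/(@compact_open_cvgP _ _ _ _ (fmap_filter _ (nbhs_filter g)))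
  => K V Kc Vo KV.
have conjV : open (@conjc R @^-1` V : set (R[i])^o).
  by move/continuousP : (@continuous_conjc R); apply.
have nbhsW : nbhs (set_val g : {compact-open, G -> (R[i])^o})
    [set h | h @` K `<=` @conjc R @^-1` V].
  apply: open_nbhs_nbhs; split; first exact: compact_open_open.
  by move=> _ [x Kx <-]; apply: KV; exists x.
have := @initial_continuous D _ set_val g _ nbhsW.
apply: (@filterS _ (nbhs g) (nbhs_filter g)) => h hK _ [x Kx <-].
by apply: (hK (pairing x h)); exists x.
Qed.

(** Both sides give 1 when multiplied by [pairing x g]: one by multiplicativity, the other because
    the modulus is one. *)
Lemma pairingN x g : pairing (- x) g = conjc (pairing x g).
Proof.
have [_ gD g1] := pairing_is_character g.
have g0 : pairing x g != 0 by rewrite -normr_eq0 g1 oner_eq0.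
have p0 : pairing 0 g = 1.
  by apply: (mulfI g0); rewrite mulr1 -gD addr0.
by apply: (mulfI g0); rewrite -gD subrr p0 -sqr_normc g1 expr1n.
Qed.

Lemma pairing_trivial x : pairing x (point : D) = 1.
Proof. by []. Qed.

End dual_group_theory.

(** * Integration against a charge *)

Section charge_integral_theory.
Context {d} {T : measurableType d} {R : realType}.
Variable nu : {charge set T -> \bar R}.

(** Exposes the Hahn decomposition chosen inside [charge_integral]; a single one serves every
    integrand, so the Jordan parts can be fixed once. *)
Lemma charge_integralE : exists P N (PN : hahn_decomposition nu P N),
  forall f, charge_integral nu f =
    \int[jordan_pos PN]_t f t - \int[jordan_neg PN]_t f t.
Proof.
rewrite /charge_integral; case: cid => P HP; case: cid => N PN.
by exists P, N, PN.
Qed.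

End charge_integral_theory.

(** * Integrals of the sine kernel *)

Section sine_integral.
Context {R : realType} {G : topologicalZmodType}.
Local Open Scope classical_set_scope.
Local Notation D := (dual_group R G).
Implicit Type m : {measure set borel D -> \bar R}.

(** The sign follows the conjugate in the Fourier-Stieltjes kernel, so this is minus the imaginary
    part of the character. *)
Definition sine (x : G) (g : borel D) : R := complex.Im (conjc (pairing x g)).

Lemma measurable_sine x : measurable_fun setT (sine x).
Proof.
apply: (@continuous_measurable_real R D) => g.
apply: (@continuous_comp _ (R[i])^o); last exact: continuous_Im.
apply: (@continuous_comp _ (R[i])^o); last exact: continuous_conjc.
exact: continuous_pairing.
Qed.

Lemma sine_conj x g : sine x (conj_character g) = - sine x g.
Proof. by rewrite /sine pairing_conj; case: (pairing x g) => a b /=. Qed.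

Lemma sine_trivial x : sine x (point : D) = 0.
Proof. by rewrite /sine pairing_trivial /= oppr0. Qed.

Lemma sineN x : sine (- x) = (fun g => - sine x g).
Proof.
apply/funext => g; rewrite /sine pairingN.
by case: (pairing x g) => a b /=.
Qed.

Lemma integrable_sine m x : (m setT < +oo)%E ->
  m.-integrable setT (EFin \o sine x).
Proof.
move=> mfin; apply: measurable_bounded_integrable => //.
  exact: measurable_sine.
exists 1; split => // M M1 g _ /=; apply: le_trans (ltW M1).
have [_ _ g1] := pairing_is_character g.
apply: le_trans (abs_im_le_norm _) _; by rewrite normcJ g1.
Qed.

Lemma integral_sineN m x : (m setT < +oo)%E ->
  \int[m]_g (- sine x g) = - \int[m]_g sine x g.
Proof.
move=> mfin; rewrite -mulN1r -RintegralZl//; last exact: integrable_sine.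
by apply: eq_Rintegral => g _; rewrite mulN1r.
Qed.

Lemma measurable_conj_character :
  measurable_fun setT (conj_character : borel D -> borel D).
Proof. exact: continuous_measurable_borel continuous_conj_character. Qed.

(** The measure structure of a pushforward depends on measurability of the map, so the instance is
    applied to that proof explicitly. *)
Definition conj_measure m : {measure set borel D -> \bar R} :=
  measure_function_pushforward__canonical__measure_function_Measure
    m measurable_conj_character.

Lemma integral_sine_conj m x : (m setT < +oo)%E ->
  \int[conj_measure m]_g sine x g = - \int[m]_g sine x g.
Proof.
move=> mfin; rewrite -integral_sineN// /Rintegral.
rewrite (integral_pushforward measurable_conj_character)//.
- by congr fine; apply: eq_integral => g _; rewrite /= sine_conj.
- by apply/measurable_EFinP; exact: measurable_sine.
- rewrite preimage_setT (_ : _ \o _ = \- (EFin \o sine x))%E.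
    by apply: integrableN; exact: integrable_sine.
  by apply/funext => g /=; rewrite sine_conj.
Qed.

Lemma integral_sine_scaled_dirac (k : {nonneg R}) x :
  \int[mscale k (@dirac _ (borel D) point R)]_g sine x g = 0.
Proof.
have ms : measurable_fun setT (EFin \o sine x).
  by apply/measurable_EFinP; exact: measurable_sine.
(* Nonnegative functions vanishing at the trivial character integrate to 0; this is applied to the
   positive and negative parts of the sine. *)
have int0 (f : borel D -> \bar R) : measurable_fun setT f ->
    (forall g, 0 <= f g)%E -> f point = 0%E ->
    (\int[mscale k (@dirac _ (borel D) point R)]_g f g = 0)%E.
  move=> mf f0 fp; rewrite ge0_integral_mscale// integral_dirac//.
  by rewrite fp !mule0.
rewrite /Rintegral integralE !int0 ?sube0//.
- exact: measurable_funeneg.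
- by rewrite funenegE /= sine_trivial oppr0 maxxx.
- exact: measurable_funepos.
- by rewrite funeposE /= sine_trivial maxxx.
Qed.

Lemma integral_sine_add m1 m2 x : (m1 setT < +oo)%E -> (m2 setT < +oo)%E ->
  \int[measure_add m1 m2]_g sine x g = \int[m1]_g sine x g + \int[m2]_g sine x g.
Proof.
move=> fin1 fin2; have [i1 i2] := (integrable_sine m1 x fin1,
  integrable_sine m2 x fin2).
rewrite /Rintegral (integral_measure_add _ i1 i2)//.
by rewrite fineD// integrable_fin_num.
Qed.

End sine_integral.

(** * Construction of the representing probability measure *)

Theorem theorem1 (R : realType) (G : topologicalZmodType)
  (G_lc : locally_compact [set: G]) (G_hausdorff : hausdorff_space G)
  (phi : G -> R[i]) :
  (forall x, complex.Im (phi x) = 0) ->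
  (forall x, phi (- x) = - phi x) ->
  in_B_unit_ball phi ->
  exists f : G -> R[i], characteristic_function f /\
    forall x, (complex.Im (f x))%:C = phi x.
Proof.
move=> phi_real phi_odd [w [w_reg w_norm w_phi]].
have D_hausdorff := @dual_group_hausdorff R G.
have [P [N [PN intE]]] := charge_integralE (cm_im w).
pose pos := jordan_pos PN; pose neg := jordan_neg PN.
pose total := measure_add pos neg.
have w_fin : (cm_norm w < +oo)%E by apply: le_lt_trans w_norm (ltry _).
have total_tight : tight total := jordan_tight D_hausdorff _ _ _ PN w_reg w_fin.
have total_le1 : (total setT <= 1)%E.
  by apply: le_trans w_norm; exact: jordan_le_variation.
have pos_fin : (pos setT < +oo)%E by rewrite ltey_eq fin_num_measure.
have neg_fin : (neg setT < +oo)%E by rewrite ltey_eq fin_num_measure.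
have total_fin : total setT \is a fin_num.
  by rewrite ge0_fin_numE//; apply: le_lt_trans total_le1 (ltry _).
have pos_tight : tight pos.
  apply: (tight_le D_hausdorff pos _ _ total_tight) => A mA.
  by rewrite /total measure_addE leeDl.
have neg_tight : tight neg.
  apply: (tight_le D_hausdorff neg _ _ total_tight) => A mA.
  by rewrite /total measure_addE leeDr.
have k_ge0 : 0 <= 1 - fine (total setT).
  by rewrite subr_ge0 -lee_fin fineK.
pose k := NngNum k_ge0.
pose delta : {measure set borel (dual_group R G) -> \bar R} :=
  mscale k (@dirac _ (borel (dual_group R G)) point R).
pose mu : {measure set borel (dual_group R G) -> \bar R} :=
  measure_add (measure_add neg (conj_measure pos)) delta.
have conjT : conj_measure pos setT = pos setT.
  by rewrite /conj_measure/= /pushforward preimage_setT.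
have conj_fin : (conj_measure pos setT < +oo)%E by rewrite conjT.
have deltaT : delta setT = (1 - fine (total setT))%:E.
  by rewrite /delta/= /mscale/= diracT mule1.
(* Inversion preserves the mass of [pos], so [delta] exactly fills the gap between [total] and 1. *)
have muT : mu setT = 1%E.
  have -> : mu setT = (total setT + delta setT)%E.
    transitivity (measure_add neg (conj_measure pos) setT + delta setT)%E.
      exact: measure_addE.
    congr (_ + _)%E; transitivity (neg setT + conj_measure pos setT)%E.
      exact: measure_addE.
    by rewrite conjT addeC; symmetry; exact: measure_addE.
  by rewrite deltaT -{1}(fineK total_fin) -EFinD addrC subrK.
have mu_fin : (mu setT < +oo)%E by rewrite muT ltry.
have mu_tight : tight mu.
  apply: tight_add => //; last exact: tight_scaled_dirac.
  apply: tight_add => //.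
  exact: (tight_pushforward _ _ continuous_conj_character conj_characterK).
exists (fourier_stieltjes_meas mu); split.
  by exists mu; split => //; exact: tight_regular.
move=> x.
(* [neg] keeps its sign, the reflected [pos] acquires a minus, and [delta] contributes 0: the Jordan
   difference appears negated. *)
have im_mu : complex.Im (fourier_stieltjes_meas mu x)
    = - charge_integral (cm_im w) (sine x).
  rewrite intE opprB -[LHS]/(\int[mu]_g sine x g).
  have sum_fin : (measure_add neg (conj_measure pos) setT < +oo)%E.
    by rewrite measure_addE lte_add_pinfty.
  have delta_fin : (delta setT < +oo)%E by rewrite deltaT ltry.
  rewrite integral_sine_add// integral_sine_add//
    integral_sine_scaled_dirac addr0.
  by rewrite integral_sine_conj.
(* The cosine is even and the sine odd in [y], so comparing [phi] at [x] and [- x] isolates the sine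
   term. *)
pose cosine y := fun g : dual_group R G => complex.Re (conjc (pairing y g)).
have re_phi y : complex.Re (phi y)
    = charge_integral (cm_re w) (cosine y) - charge_integral (cm_im w) (sine y).
  by rewrite -w_phi.
have cosineN : cosine (- x) = cosine x.
  apply/funext => g; rewrite /cosine pairingN.
  by case: (pairing x g).
have sine_intN : charge_integral (cm_im w) (sine (- x))
    = - charge_integral (cm_im w) (sine x).
  by rewrite !intE sineN !integral_sineN// -opprB opprK addrC opprB.
have := re_phi (- x); rewrite phi_odd cosineN sine_intN raddfN /= => re_phiN.
have re_phix := re_phi x.
apply/eqP; rewrite eq_complex phi_real eqxx andbT; apply/eqP.
(* With c and s the cosine and sine integrals in [re_phix], the real part r of [phi x] satisfies r =
   c - s and -r = c + s, whence r = -s. *)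
apply: (etrans im_mu); lra.
Qed.
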